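(* A finite simple graph $G$ satisfies $\rho_1(G)=\rho_2(G)$ if and only if the simplicial cliques of $G$ partition $V(G)$.
   Context: For a graph $G$ and integer $k\ge1$, a $k$-packing is a set of vertices with pairwise distances larger than $k$, and $\rho_k(G)$ is the maximum size of a $k$-packing (so $\rho_1(G)$ is the independence number). A vertex $v$ is simplicial if its closed neighborhood $N_G[v]$ induces a complete subgraph. A simplicial clique is a (maximal) clique containing a simplicial vertex, i.e. a set $N_G[v]$ for a simplicial vertex $v$. *)

(* Defs.v *)
From mathcomp Require Import all_boot.
Set Implicit Arguments.
Unset Strict Implicit.
Unset Printing Implicit Defensive.

(* A finite simple graph is a finType T of vertices together with an adjacency
   relation e that is symmetric and irreflexive. The definitions below take any
   e : rel T; symmetry and irreflexivity are hypotheses of the results. *)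

Section Graph.
Variables (T : finType) (e : rel T).
Implicit Types (u v x y : T) (S C : {set T}) (k n : nat).

Definition walk_of_length n u v : bool :=
  [exists p : n.-tuple T, path e u p && (last u p == v)].

Lemma connect_walk u v : connect e u v -> exists n, walk_of_length n u v.
Proof.
case/connectP=> p ep ->; exists (size p); apply/existsP; exists (in_tuple p).
by rewrite ep eqxx.
Qed.

(* None stands for the infinite distance between vertices of different
   connected components. *)
Definition dist u v : option nat :=
  match @idP (connect e u v) with
  | ReflectT uv => Some (ex_minn (connect_walk uv))
  | ReflectF _ => None
  end.

Definition dist_gt u v k : bool := if dist u v is Some n then k < n else true.

Definition packing k S : bool :=
  [forall x in S, forall y in S, (x != y) ==> dist_gt x y k].

Definition rho k : nat := \max_(S : {set T} | packing k S) #|S|.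

Definition clique S : bool :=
  [forall x in S, forall y in S, (x != y) ==> e x y].

Definition closed_nbhd v : {set T} := [set u | (u == v) || e v u].

Definition simplicial v : bool := clique (closed_nbhd v).

Definition simplicial_clique C : bool :=
  maxset clique C && [exists v in C, simplicial v].

Definition simplicial_cliques : {set {set T}} := [set C | simplicial_clique C].

Lemma cliqueP S :
  reflect {in S &, forall x y, x != y -> e x y} (clique S).
Proof.
apply: (iffP forall_inP) => [cS x y xS yS xy | cS x xS].
  by move/forall_inP/(_ y yS)/implyP: (cS x xS); apply.
by apply/forall_inP=> y yS; apply/implyP; apply: cS.
Qed.

Lemma simplicial_cliquesE :
  simplicial_cliques = [set closed_nbhd v | v : T & simplicial v].
Proof.
have sub v C : clique C -> v \in C -> C \subset closed_nbhd v.
  move=> /cliqueP cC vC; apply/subsetP=> u uC; rewrite inE.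
  by have [//|uv] := eqVneq u v; apply: cC => //; rewrite eq_sym.
have self v : v \in closed_nbhd v by rewrite inE eqxx.
apply/setP=> C; rewrite inE; apply/andP/imsetP.
  case=> /maxsetP[cC maxC] /exists_inP[v vC sv]; exists v; rewrite ?inE //.
  by apply/esym/maxC; last exact: sub.
case=> v; rewrite inE => sv ->; split; last by apply/exists_inP; exists v.
apply/maxsetP; split=> // B cB vB.
by apply/eqP; rewrite eqEsubset vB andbT sub // (subsetP vB).
Qed.

End Graph.

(* Main.v *)
Require Import Defs.
From mathcomp Require Import all_boot.

Set Implicit Arguments.
Unset Strict Implicit.
Unset Printing Implicit Defensive.

(** If the simplicial cliques partition the vertices, one simplicial vertex from
    each of them gives a 2-packing, while an independent set meets each clique
    at most once, so [rho 1 <= rho 2]; the other inequality always holds.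
    Conversely let [S] be a maximum 2-packing with [#|S| = rho 1]. A vertex
    outside all the closed neighborhoods of [S] could be added to [S], and two
    nonadjacent neighbors of some [v] in [S] could replace [v], giving in both
    cases a larger independent set. Hence the [N[v]], [v] in [S], are disjoint
    cliques covering the graph, and any simplicial clique equals the one
    containing its simplicial vertex. *)

Section Packing.
Variables (T : finType) (e : rel T).
Hypotheses (e_sym : symmetric e) (e_irr : irreflexive e).
Implicit Types (u v x y : T) (S C : {set T}) (k n : nat).

Local Notation N := (closed_nbhd e).

(** Eliminates both the minimum and the infinite case of [dist]: between different components there
    is no walk, so the right-hand side holds vacuously. *)
Lemma dist_gtP u v k :
  reflect (forall n, walk_of_length e n u v -> k < n) (dist_gt e u v k).
Proof.
rewrite /dist_gt /dist; destruct (@idP (connect e u v)) as [uv|nuv].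
  case: ex_minnP => m wm min_m; apply: (iffP idP) => [km n wn|]; last exact.
  exact: leq_trans km (min_m n wn).
left=> n /existsP[p /andP[ep /eqP pv]].
by case: nuv; apply/connectP; exists p.
Qed.

Lemma walk_of_length0 u v : walk_of_length e 0 u v = (u == v).
Proof.
apply/existsP/idP => [[p]|uv]; first by rewrite tuple0.
by exists [tuple].
Qed.

Lemma walk_of_lengthS n u v :
  walk_of_length e n.+1 u v = [exists w, e u w && walk_of_length e n w v].
Proof.
apply/existsP/existsP=> [[p]|[w /andP[uw /existsP[p wv]]]].
  case/tupleP: p => w p /= /andP[/andP[uw ep] pv]; exists w.
  by rewrite uw; apply/existsP; exists p; rewrite ep.
by exists [tuple of w :: p]; rewrite /= uw.
Qed.

Lemma dist_gt1 x y : x != y -> dist_gt e x y 1 = ~~ e x y.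
Proof.
move=> xy; apply/dist_gtP/idP => [far | nxy [|[|//]]].
- apply/negP=> exy; have /far// : walk_of_length e 1 x y.
  rewrite walk_of_lengthS; apply/existsP; exists y.
  by rewrite exy walk_of_length0 /=.
- by rewrite walk_of_length0 (negPf xy).
rewrite walk_of_lengthS => /existsP[w /andP[xw]].
by rewrite walk_of_length0 => /eqP wy; rewrite wy (negPf nxy) in xw.
Qed.

Lemma closed_nbhd_self x : x \in N x.
Proof. by rewrite inE eqxx. Qed.

Lemma closed_nbhd_sym x y : (x \in N y) = (y \in N x).
Proof. by rewrite !inE e_sym eq_sym. Qed.

(** A common vertex [w] of [N x] and [N y] is either an end of the edge [x y] or the middle of a
    walk of length 2; conversely, walks of length 1 and 2 yield such a [w]. *)
Lemma dist_gt2 x y : x != y -> dist_gt e x y 2 = [disjoint N x & N y].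
Proof.
move=> xy; apply/dist_gtP/idP => [far | dis [|[|[|//]]]].
- have nxy : ~~ e x y.
    by rewrite -dist_gt1 //; apply/dist_gtP=> n /far; apply: ltnW.
  apply/pred0P=> w /=; rewrite !inE; apply/negP=> /andP[].
  have [->|_ /= xw] := eqVneq w x.
    by rewrite (negPf xy) /= e_sym (negPf nxy).
  have [wy|_ /= yw] := eqVneq w y; first by rewrite wy (negPf nxy) in xw.
  have /far// : walk_of_length e 2 x y.
  rewrite walk_of_lengthS; apply/existsP; exists w; rewrite xw /=.
  rewrite walk_of_lengthS; apply/existsP; exists y.
  by rewrite e_sym yw walk_of_length0 /=.
- by rewrite walk_of_length0 (negPf xy).
- rewrite walk_of_lengthS => /existsP[w /andP[xw]].
  rewrite walk_of_length0 => /eqP wy; rewrite wy in xw.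
  have yx : y \in N x by rewrite inE xw orbT.
  by have := disjointFr dis yx; rewrite closed_nbhd_self.
rewrite walk_of_lengthS => /existsP[w /andP[xw]].
rewrite walk_of_lengthS => /existsP[z /andP[wz]].
rewrite walk_of_length0 => /eqP zy; rewrite zy e_sym in wz.
have wx : w \in N x by rewrite inE xw orbT.
by have := disjointFr dis wx; rewrite inE wz orbT.
Qed.

Lemma packing1P S : reflect {in S &, forall x y, ~~ e x y} (packing e 1 S).
Proof.
apply: (iffP forall_inP) => [pS x y xS yS | iS x xS].
  have [->|xy] := eqVneq x y; first by rewrite e_irr.
  by rewrite -dist_gt1 //; move/forall_inP/(_ y yS)/implyP: (pS x xS); apply.
apply/forall_inP=> y yS; apply/implyP=> xy.
by rewrite dist_gt1 //; apply: iS.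
Qed.

Lemma packing2P S :
  reflect {in S &, forall x y z, z \in N x -> z \in N y -> x = y}
          (packing e 2 S).
Proof.
apply: (iffP forall_inP) => [pS x y xS yS z zx zy | iS x xS].
  apply/eqP/negPn/negP=> xy.
  have := pS x xS => /forall_inP/(_ y yS)/implyP/(_ xy).
  by rewrite dist_gt2 // => /disjointFr/(_ zx); rewrite zy.
apply/forall_inP=> y yS; apply/implyP=> xy; rewrite dist_gt2 //.
apply/pred0P=> z /=; apply/negP=> /andP[zx zy].
by rewrite (iS x y xS yS z zx zy) eqxx in xy.
Qed.

Lemma packing_leq k l S : k <= l -> packing e l S -> packing e k S.
Proof.
move=> kl /forall_inP pS; apply/forall_inP=> x xS; apply/forall_inP=> y yS.
apply/implyP=> xy; have := pS x xS => /forall_inP/(_ y yS)/implyP/(_ xy).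
move=> /dist_gtP far; apply/dist_gtP=> n /far; exact: leq_ltn_trans.
Qed.

Lemma rho_leq k l : k <= l -> rho e l <= rho e k.
Proof.
move=> kl; apply/bigmax_leqP=> S pS.
exact/(bigmax_sup S)/leqnn/(packing_leq kl).
Qed.

Lemma packing0 k : packing e k set0.
Proof. by apply/forall_inP=> x; rewrite inE. Qed.

Lemma rho_witness k : exists2 S, packing e k S & rho e k = #|S|.
Proof.
rewrite /rho (bigmax_eq_arg set0) ?packing0 //.
by case: arg_maxnP => [|S pS _]; [apply: packing0 | exists S].
Qed.

Section MaxPacking.
Variable S : {set T}.
Hypotheses (pS : packing e 2 S) (maxS : rho e 1 = #|S|).

Let pS1 : {in S &, forall x y, ~~ e x y}.
Proof. exact/packing1P/(packing_leq _ pS). Qed.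

Let maxS1 A : packing e 1 A -> #|A| <= #|S|.
Proof. by move=> pA; rewrite -maxS; apply: (bigmax_sup A). Qed.

Lemma max_packing_cover x : exists2 v, v \in S & x \in N v.
Proof.
have [/exists_inP//|/exists_inPn nx] := boolP [exists v in S, x \in N v].
have nxS v : v \in S -> ~~ e x v.
  by move=> /nx; rewrite inE negb_or e_sym => /andP[].
suff /maxS1 : packing e 1 (x |: S).
  rewrite cardsU1 (_ : x \notin S) ?ltnn //.
  by apply/negP=> /nx; rewrite closed_nbhd_self.
apply/packing1P=> u v /setU1P[->|uS] /setU1P[->|vS]; rewrite ?e_irr ?nxS //.
  by rewrite e_sym nxS.
exact: pS1.
Qed.

Lemma max_packing_simplicial v : v \in S -> simplicial e v.
Proof.
move=> vS; apply/cliqueP=> x y xv yv xy; apply/negPn/negP=> nxy.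
(* The closed neighborhoods of [S] are disjoint, so a neighbor of [v] is nonadjacent to the rest of
   [S]. *)
have far w u : w \in N v -> u \in S :\ v -> u \notin N w.
  move=> wv /setD1P[uv uS]; rewrite closed_nbhd_sym; apply: contra uv => wu.
  by apply/eqP; apply: (packing2P _ pS u v uS vS w).
have nS w : w \in N v -> w \notin S :\ v.
  by move=> wv; apply/negP=> /(far w w wv); rewrite closed_nbhd_self.
have nadj w u : w \in N v -> u \in S :\ v -> ~~ e w u.
  by move=> wv /(far w u wv); rewrite inE negb_or => /andP[].
(* The exchange: one vertex leaves [S] and two new ones enter, exceeding the maximum by one. *)
suff /maxS1 : packing e 1 (x |: (y |: S :\ v)).
  rewrite !cardsU1 in_setU1 negb_or xy !nS // (cardsD1 v S) vS.
  by rewrite !add1n ltnn.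
have nyx : ~~ e y x by rewrite e_sym.
have nadj' w u : w \in N v -> u \in S :\ v -> ~~ e u w.
  by rewrite e_sym; apply: nadj.
apply/packing1P=> a b /setU1P[->|/setU1P[->|aS]] /setU1P[->|/setU1P[->|bS]];
  rewrite ?e_irr //; do ?[exact: nadj | exact: nadj'].
by move: aS bS => /setD1P[_ aS] /setD1P[_ bS]; apply: pS1.
Qed.

Lemma max_packing_cliques : simplicial_cliques e = N @: S.
Proof.
rewrite simplicial_cliquesE; apply/setP=> C; apply/imsetP/imsetP.
  case=> u; rewrite inE => su ->; have [v vS uv] := max_packing_cover u.
  exists v => //; apply/setP=> w.
  (* Since [u] and [v] are both simplicial and lie in each other's closed neighborhood, this gives
     both inclusions between [N u] and [N v]. *)
  have sub a b : simplicial e a -> b \in N a -> w \in N a -> w \in N b.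
    move=> /cliqueP ca ba wa; rewrite inE; have [//|wb] := eqVneq w b.
    by apply: ca => //; rewrite eq_sym.
  apply/idP/idP; apply: sub => //; first by rewrite closed_nbhd_sym.
  exact: max_packing_simplicial.
by case=> v vS ->; exists v; rewrite // inE max_packing_simplicial.
Qed.

Lemma max_packing_partition : partition (simplicial_cliques e) [set: T].
Proof.
rewrite max_packing_cliques; apply/and3P; split.
- apply/eqP/setP=> x; rewrite inE; have [v vS xv] := max_packing_cover x.
  by apply/bigcupP; exists (N v); rewrite ?imset_f.
- apply/trivIsetP=> _ _ /imsetP[u uS ->] /imsetP[v vS ->] uv.
  apply/pred0P=> z /=; apply/negP=> /andP[zu zv].
  by rewrite (packing2P _ pS u v uS vS z zu zv) eqxx in uv.
by apply/imsetP=> -[v _ /setP/(_ v)]; rewrite closed_nbhd_self inE.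
Qed.

End MaxPacking.

(** The map [pblock P] is injective on [S], because distinct vertices in one clique are adjacent. *)
Lemma independent_leq_clique_cover (P : {set {set T}}) S :
    cover P = [set: T] -> {in P, forall C, clique e C} -> packing e 1 S ->
  #|S| <= #|P|.
Proof.
move=> covP cP /packing1P iS.
have memP x : x \in cover P by rewrite covP inE.
rewrite -(card_in_imset (f := pblock P) (D := S)).
  by apply/subset_leq_card/subsetP=> _ /imsetP[x _ ->]; apply: pblock_mem.
move=> x y xS yS eq_xy; apply/eqP/negPn/negP=> xy.
have /cliqueP/(_ x y) : clique e (pblock P x) by apply/cP/pblock_mem.
(* Only the block said to contain [y] is rewritten, so that each vertex faces its own block. *)
by rewrite {2}eq_xy !mem_pblock (negPf (iS x y xS yS)) !memP => /(_ isT isT xy).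
Qed.

Lemma card_simplicial_cliques_leq_rho2 :
  trivIset (simplicial_cliques e) -> #|simplicial_cliques e| <= rho e 2.
Proof.
(* [rep] depends only on the clique, so the vertices that represent their own clique, collected in
   [A], are determined by their closed neighborhoods. *)
move=> /trivIsetP tI; pose rep C := [pick v | simplicial e v & N v == C].
pose A := [set v | rep (N v) == Some v].
have NA v : v \in A -> N v \in simplicial_cliques e.
  rewrite inE /rep; case: pickP => // w /andP[sw _] /eqP[<-].
  by rewrite simplicial_cliquesE imset_f ?inE.
have injN : {in A &, injective N}.
  move=> u v; rewrite !inE => /eqP ru /eqP rv uv.
  by apply: Some_inj; rewrite -ru -rv uv.
have /subset_leq_card/leq_trans : simplicial_cliques e \subset N @: A.
  rewrite simplicial_cliquesE; apply/subsetP=> _ /imsetP[v sv ->].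
  rewrite inE in sv.
  (* The representative [w] of [N v] satisfies [N w = N v], hence lies in [A]; the choice cannot
     fail, as [v] itself is a candidate. *)
  case Er: (rep (N v)) => [w|]; move: (Er); rewrite {1}/rep; case: pickP => //.
    move=> w' /andP[_ /eqP Nw] [ew]; rewrite ew in Nw.
    by apply/imsetP; exists w; rewrite // inE Nw Er.
  by move/(_ v); rewrite sv eqxx.
apply; rewrite card_in_imset //; apply: (bigmax_sup A) => //.
apply/packing2P=> u v uA vA z zu zv; apply: injN => //.
apply/eqP/negPn/negP=> /(tI _ _ (NA u uA) (NA v vA))/disjointFr/(_ zu).
by rewrite zv.
Qed.

End Packing.

Theorem theorem4 (T : finType) (e : rel T)
    (e_sym : symmetric e) (e_irr : irreflexive e) :
  rho e 1 = rho e 2 <-> partition (simplicial_cliques e) [set: T].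
Proof.
split=> [rho12|/and3P[/eqP covC trivC _]].
  have [S pS rhoS] := rho_witness e 2; rewrite -rho12 in rhoS.
  exact: max_packing_partition pS rhoS.
apply/eqP; rewrite eqn_leq [rho e 2 <= _]rho_leq // andbT.
have [A pA ->] := rho_witness e 1.
(* The number of simplicial cliques separates the two quantities: it bounds [#|A|] from above and
   [rho e 2] from below. *)
apply: leq_trans (card_simplicial_cliques_leq_rho2 e_sym trivC).
apply: independent_leq_clique_cover => // C.
by rewrite inE => /andP[/maxsetP[]].
Qed.
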